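(* Let $a\in\mathbb R$, $c\in(-1,1)$, let $d:\mathbb R\to[0,\breve d]$ be continuous, and consider the scalar impulsive delayed system \[ \dot\xi(t)=a\,\xi(t-d(t))+\tilde u(t)\quad(t\notin\mathcal T),\qquad \xi(t^+)=c\,\xi(t)+\tilde\nu(t)\quad(t\in\mathcal T), \] with initial segment $\xi_{t_0}\in PC([-\breve d,0],\mathbb R)$ and jump times $\mathcal T=\{t_1,t_2,\ldots\}$ satisfying $\varepsilon\le t_{i+1}-t_i\le\tau$ for all $i\in\mathbb N_0$, where $\varepsilon>0$. Assume $\tilde u\equiv0$, $\tilde\nu\equiv0$ and consider a positive constant $r$. Let $\lambda_1:=\frac{a^2}{r}$, and $\lambda_2:=c^2$ if $c\ne0$, or merely $\lambda_2\in(0,1)$ if $c=0$. If there exist constants $\lambda>0$, $M>1$ such that (I) $\tau\big(\lambda+r+\lambda_1Me^{-\lambda\tau}\big)<\ln M$, and (II) $\tau\big(\lambda+r+\frac{\lambda_1}{\lambda_2}e^{\lambda\breve d}\big)<-\ln\lambda_2$ hold, then the system is UGES and $\|\xi(t)\|\le\sqrt M\,\|\xi_{t_0}\|\,e^{-\frac{\lambda}{2}(t-t_0)}$ for all $t\ge t_0$.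
   Context: $PC([a,b],\mathcal S)$ is the set of functions $\phi:[a,b]\to\mathcal S$ that are right-continuous on $[a,b)$, have left limits in $\mathcal S$ on $(a,b]$, and satisfy $\phi(t^-)=\phi(t)$ at all but finitely many points. $\xi_t(\theta):=\xi(t+\theta)$ for $-\breve d\le\theta\le0$, and $\|\xi_t\|:=\sup_{-\breve d\le\theta\le0}\|\xi(t+\theta)\|$; $\|\cdot\|$ on $\mathbb R$ is the absolute value. Solutions are right-continuous functions; at a jump instant $t\in\mathcal T$ the right-hand side of the jump equation uses the value of $\xi$ just before the jump, and $\xi(t^+)$ is the value after the jump. $t_0$ is the initial time, there is no jump at $t_0$, and $t_1<t_2<\cdots$ are the jump times after $t_0$. *UGES (uniformly globally exponentially stable), for zero inputs:* there exist positive constants $\lambda'$ and $M'$ such that, for each $t_0\in\mathbb R$ and each $\xi_{t_0}\in PC([-\breve d,0],\mathbb R)$, each solution satisfies $\|\xi(t)\|\le M'\|\xi_{t_0}\|e^{-\lambda'(t-t_0)}$ for each $t\ge t_0$ (the constants being uniform over the initial time and over jump sequences following it with the stated spacing). *)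

(* Defs.v *)
(* Library: MathComp-Analysis. *)
From HB Require Import structures.
From mathcomp Require Import all_boot all_order all_algebra.
From mathcomp Require Import all_classical all_reals all_analysis.
Set Implicit Arguments.
Unset Strict Implicit.
Unset Printing Implicit Defensive.
Import Order.TTheory GRing.Theory Num.Theory.
Import numFieldNormedType.Exports.
Local Open Scope classical_set_scope.
Local Open Scope ring_scope.

(* PC([a, b], R).  Functions on [a, b] are represented by total functions
   whose values outside [a, b] are irrelevant. *)
Definition PC (R : realType) (a b : R) (phi : R -> R) : Prop :=
  [/\ forall t, a <= t < b -> phi s @[s --> t^'+] --> phi t,
      forall t, a < t <= b -> cvg (phi s @[s --> t^'-])
    & finite_set [set t | a < t <= b /\ ~ (phi s @[s --> t^'-] --> phi t)]].

(* xi_t *)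
Definition segment (R : realType) (xi : R -> R) (t : R) : R -> R :=
  fun theta => xi (t + theta).

(* The supremum norm on [-dbar, 0]; [sup] is the genuine supremum on segments
   in PC([-dbar, 0], R), which are bounded. *)
Definition segment_norm (R : realType) (dbar : R) (phi : R -> R) : R :=
  sup [set `|phi theta| | theta in `[- dbar, 0]%classic].

(* [tk 0] is the initial time (not a jump time); [tk i.+1], i >= 0, are the
   jump times. *)
Definition jump_sequence (R : realType) (eps tau t0 : R) (tk : nat -> R)
    : Prop :=
  tk 0%N = t0 /\ forall i, eps <= tk i.+1 - tk i <= tau.

Definition abs_continuous (R : realType) (a b : R) (f : R -> R) : Prop :=
  forall e : R, 0 < e -> exists2 delta : R, 0 < delta &
    forall (n : nat) (x y : 'I_n -> R),
      (forall i, [/\ a <= x i, x i <= y i & y i <= b]) ->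
      trivIset setT (fun i => `]x i, y i[%classic) ->
      \sum_(i < n) (y i - x i) < delta ->
      \sum_(i < n) `|f (y i) - f (x i)| < e.

(* Solutions of
     xi'(t) = a xi(t - d(t)) + u(t)   (t not a jump time),
     xi(t^+) = c xi(t) + nu(t)        (t a jump time),
   on [t0 - dbar, +oo[ are taken in the sense of Caratheodory: the delayed
   argument may cross discontinuities of xi, so the differential equation is
   required almost everywhere, together with absolute continuity on the
   compact subintervals of each [tk i, tk i.+1[.  The latter includes the right
   continuity at tk i; hence at a jump time xi(t^+) is the value of xi and the
   xi(t) of the jump equation is the left limit of xi. *)
Definition solution (R : realType) (a c dbar : R) (d u nu : R -> R)
    (t0 : R) (tk : nat -> R) (xi : R -> R) : Prop :=
  [/\ PC (- dbar) 0 (segment xi t0),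
      forall (i : nat) (s : R), tk i <= s < tk i.+1 ->
        abs_continuous (tk i) s xi,
      {ae @lebesgue_measure R, forall t : R,
        t0 < t -> (forall i : nat, t <> tk i.+1) ->
        is_derive t 1 xi (a * xi (t - d t) + u t)}
    & forall i : nat, exists2 l : R,
        xi s @[s --> (tk i.+1)^'-] --> l &
        xi (tk i.+1) = c * l + nu (tk i.+1)].

Definition UGES (R : realType) (a c dbar : R) (d : R -> R) (eps tau : R)
    : Prop :=
  exists lambda' M' : R, [/\ 0 < lambda', 0 < M' &
    forall (t0 : R) (tk : nat -> R) (xi : R -> R),
      jump_sequence eps tau t0 tk ->
      solution a c dbar d (fun=> 0) (fun=> 0) t0 tk xi ->
      forall t : R, t0 <= t ->
        `|xi t| <= M' * segment_norm dbar (segment xi t0)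
                   * expR (- lambda' * (t - t0))].

(* Main.v *)
(* The proof is a barrier argument for V = xi^2, which off the jumps satisfies
   V'(t) <= r V(t) + lambda1 V(t - d(t)) by Young's inequality.  Let V0 bound V
   on the initial segment.

   On [t0, t1[, condition (I) keeps V below B = M e^(-lambda tau) V0: while
   V0 <= V <= B, one has V' <= (r + lambda1 M e^(-lambda tau)) V, so V cannot
   climb from V0 to B within time tau.

   On later intervals the barrier concerns W(t) = V(t) e^(lambda t).  If W <= C
   up to a jump, then W <= lambda2 C right after it, and while
   lambda2 C <= W <= C one has
   W' <= (lambda + r + (lambda1 / lambda2) e^(lambda dbar)) W,
   so by (II) W cannot climb back to C before the next jump.

   Since xi is only a Caratheodory solution, growth is controlled by the fact
   that an absolutely continuous function with nonpositive derivative almost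
   everywhere is nonincreasing. *)
Require Import Defs.
From mathcomp Require Import all_boot all_order all_algebra.
From mathcomp Require Import all_classical all_reals all_analysis.
From mathcomp Require Import lra ring.
Set Implicit Arguments.
Unset Strict Implicit.
Unset Printing Implicit Defensive.
Import Order.TTheory GRing.Theory Num.Theory.
Import numFieldNormedType.Exports.
Local Open Scope classical_set_scope.
Local Open Scope ring_scope.

(** * Induction along real intervals and its compactness consequences *)

(** Take the supremum of the points up to which [P] holds: the first hypothesis gives [P] there, and
    the second pushes past it unless it is [b]. The base case at [a] is the first hypothesis with a
    vacuous premise. *)
Lemma real_induction (R : realType) (a b : R) (P : R -> Prop) :
  (forall t, a <= t <= b -> (forall x, a <= x < t -> P x) -> P t) ->
  (forall t, a <= t < b -> (forall x, a <= x <= t -> P x) ->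
    exists2 e : R, 0 < e & forall y, t < y <= b -> y < t + e -> P y) ->
  forall t, a <= t <= b -> P t.
Proof.
move=> Pclosed Popen t0 /andP[at0 t0b].
have ab : a <= b by exact: le_trans at0 t0b.
pose S := [set x | a <= x <= b /\ forall z, a <= z <= x -> P z].
have Pa : P a.
  by apply: Pclosed => [|x /andP[ax xa]]; rewrite ?lexx//; exfalso; lra.
have Sa : S a.
  split=> [|z /andP[az za]]; first by rewrite lexx.
  by have -> : z = a by lra.
have Sub : has_ubound S by exists b => x [/andP[]].
have Ssup : has_sup S by split => //; exists a.
have aS : a <= sup S by exact: ub_le_sup.
have Sb : sup S <= b by apply: ge_sup => [|x [/andP[]]//]; exists a.
have Plt x : a <= x < sup S -> P x.
  move=> /andP[ax xS]; have e0 : 0 < sup S - x by lra.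
  have [y [/andP[ay yb] Py] xy] := sup_adherent e0 Ssup.
  by apply: Py; lra.
have PS : P (sup S) by apply: Pclosed => //; lra.
have Ple x : a <= x <= sup S -> P x.
  move=> /andP[ax]; rewrite le_eqVlt => /predU1P[->//|xS].
  by apply: Plt; lra.
have [Sbeq|Sltb] := eqVneq (sup S) b; first by apply: Ple; lra.
have {}Sltb : sup S < b by rewrite lt_neqAle Sltb.
have [|e e0 Pe] := Popen _ _ Ple; first by lra.
pose y := Num.min b (sup S + e / 2).
have : S y.
  have yb : y <= b by rewrite /y ge_min lexx.
  have ye : y <= sup S + e / 2 by rewrite /y ge_min lexx orbT.
  have Sy : sup S <= y by rewrite /y le_min; apply/andP; split; lra.
  split=> [|z /andP[az zy]]; first by lra.
  by have [zS|Sz] := leP z (sup S); [apply: Ple|apply: Pe]; lra.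
move=> /(ub_le_sup Sub); rewrite /y minEle; case: ifP => _ ?; exfalso; lra.
Qed.

(** A form of Cousin's lemma: [[a, b]] is crossed by finitely many small cells, each tagged by a
    point [t] that it contains. Real induction uses a cell ending at [t] for the closed step and one
    starting at [t] for the open step. *)
Lemma straddle_induction (R : realType) (a b : R) (P : R -> Prop) :
  a <= b -> P a ->
  (forall t, a <= t <= b -> exists2 e : R, 0 < e &
    forall x y, a <= x <= t -> t <= y <= b -> t - e < x -> y < t + e ->
      P x -> P y) ->
  P b.
Proof.
move=> ab Pa Pstep; apply: (@real_induction R a b P); last by rewrite ab lexx.
- move=> t tab Plt; have [e e0 He] := Pstep _ tab.
  have [<-//|ta] := eqVneq a t.
  have {}ta : a < t by rewrite lt_neqAle ta; case/andP: tab.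
  pose x := Num.max a (t - e / 2).
  have ax : a <= x by rewrite /x le_max lexx.
  have tx : t - e / 2 <= x by rewrite /x le_max lexx orbT.
  have xt : x < t by rewrite /x gt_max ta /=; lra.
  by apply: (He x); rewrite ?lexx ?ax ?(ltW xt)//=; [| | | apply: Plt]; lra.
- move=> t tab Ple; have tab' : a <= t <= b by lra.
  have [e e0 He] := Pstep _ tab'; exists e => // y ty yt.
  by apply: (He t) => //; [| | | apply: Ple]; lra.
Qed.

Lemma locally_bounded_segment (R : realType) (a b : R) (f : R -> R) :
  (forall t, a <= t <= b -> exists2 e : R, 0 < e & exists B : R,
    forall x, a <= x <= b -> t - e < x < t + e -> `|f x| <= B) ->
  exists B : R, forall x, a <= x <= b -> `|f x| <= B.
Proof.
move=> f_loc; have [ab|ba] := leP a b; last first.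
  by exists 0 => x /andP[ax xb]; exfalso; lra.
pose P y := exists B : R, forall x, a <= x <= y -> `|f x| <= B.
suff [] : P b by move=> B HB; exists B.
apply: (@straddle_induction R a b P ab).
  by exists `|f a| => x /andP[ax xa]; have -> : x = a by lra.
move=> t tab; have [e e0 [B' HB']] := f_loc _ tab.
exists e => // x y axt tyb tx yt [B HB].
exists (Num.max B B') => z /andP[az zy]; rewrite le_max.
by have [zx|xz] := leP z x; [rewrite HB ?az|rewrite HB' ?orbT//]; lra.
Qed.

(** The point [s] is the supremum of the sublevel set, which continuity keeps inside that set. *)
Lemma last_exit (R : realType) (p q A : R) (w : R -> R) :
  p <= q -> w p <= A ->
  (forall e, 0 < e -> exists2 delta, 0 < delta & forall x y,
    p <= x <= q -> p <= y <= q -> `|x - y| < delta -> `|w x - w y| < e) ->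
  exists s : R, [/\ p <= s <= q, w s <= A & forall x, s < x <= q -> A < w x].
Proof.
move=> pq wpA wcont.
pose S := [set x | p <= x <= q /\ w x <= A].
have Sp : S p by split => //; rewrite lexx.
have Sub : has_ubound S by exists q => x [/andP[]].
have Ssup : has_sup S by split => //; exists p.
have pS : p <= sup S by exact: ub_le_sup.
have Sq : sup S <= q by apply: ge_sup => [|x [/andP[]]//]; exists p.
exists (sup S); split; first by rewrite pS.
- rewrite leNgt; apply/negP => AwS.
  have [|d d0 Hd] := wcont (w (sup S) - A); first by lra.
  have [y [pyq wyA] Sy] := sup_adherent d0 Ssup.
  have yS : y <= sup S by exact: ub_le_sup.
  have : `|w (sup S) - w y| < w (sup S) - A.
    by apply: Hd; rewrite ?ger0_norm; lra.
  by rewrite ger0_norm; lra.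
- move=> x /andP[Sx xq]; rewrite ltNge; apply/negP => wxA.
  have : x <= sup S by apply: ub_le_sup => //; split => //; lra.
  by lra.
Qed.

(** Near each point, the right limit, the left limit and the value each give a bound; compactness
    makes these bounds uniform. *)
Lemma PC_bounded (R : realType) (a b : R) (phi : R -> R) :
  PC a b phi -> exists B : R, forall x, a <= x <= b -> `|phi x| <= B.
Proof.
move=> [phir phil _]; apply: locally_bounded_segment => t /andP[at_ tb].
have [e1 e10 [B1 HB1]] : exists2 e : R, 0 < e & exists B : R,
    forall x, x <= b -> t < x < t + e -> `|phi x| <= B.
  have [bt|tltb] := leP b t.
    by exists 1 => //; exists 0 => x xb /andP[tx _]; exfalso; lra.
  have /phir/cvgr_dist_lt/(_ _ ltr01) : a <= t < b by rewrite at_.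
  rewrite near_withinE => /nbhs_ballP[e /= e0 He].
  exists e => //; exists (`|phi t| + 1) => x xb /andP[tx xt].
  have /He/(_ tx) : ball t e x.
    by rewrite /ball/= ltr_norml; apply/andP; split; lra.
  by have := ler_distD (phi t) 0 (phi x); rewrite !sub0r !normrN distrC; lra.
have [e2 e20 [B2 HB2]] : exists2 e : R, 0 < e & exists B : R,
    forall x, a <= x -> t - e < x < t -> `|phi x| <= B.
  have [ta|altt] := leP t a.
    by exists 1 => //; exists 0 => x ax /andP[_ xt]; exfalso; lra.
  have /phil/cvg_ex[l /cvgr_dist_lt/(_ _ ltr01)] : a < t <= b by rewrite altt.
  rewrite near_withinE => /nbhs_ballP[e /= e0 He].
  exists e => //; exists (`|l| + 1) => x xb /andP[tx xt].
  have /He/(_ xt) : ball t e x.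
    by rewrite /ball/= ltr_norml; apply/andP; split; lra.
  by have := ler_distD l 0 (phi x); rewrite !sub0r !normrN distrC; lra.
exists (Num.min e1 e2); first by rewrite lt_min e10.
exists (Num.max `|phi t| (Num.max B1 B2)) => x /andP[ax xb] /andP[].
rewrite ltrBlDr -ltrBlDl lt_min -ltrBlDl lt_min !le_max.
move=> /andP[? ?] /andP[? ?].
have [xt|xt|->] := ltgtP x t; last by rewrite lexx.
- by rewrite HB2 ?orbT//; lra.
- by rewrite HB1 ?orbT//; lra.
Qed.

(** * Increment estimates for the exponential and for differentiable functions *)

(** The tangent inequality [1 + x <= expR x] at the larger argument bounds the slope by the larger
    exponential. *)
Lemma expR_dist_le (R : realType) (u v D : R) : expR u <= D -> expR v <= D ->
  `|expR u - expR v| <= D * `|u - v|.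
Proof.
have wl (s t : R) : s <= t -> expR t <= D -> expR t - expR s <= D * (t - s).
  move=> st tD; have := expR_ge1Dx (s - t); rewrite expRD expRN => H.
  have t0 := expR_gt0 t.
  have : expR t - expR s <= expR t * (t - s).
    by move: H; rewrite -(ler_pM2r t0) mulfVK ?gt_eqF//; lra.
  by move=> /le_trans; apply; apply: ler_wpM2r => //; lra.
move=> uD vD; have [uv|vu] := leP u v.
  rewrite distrC ger0_norm ?subr_ge0 ?ler_expR//.
  by rewrite distrC ger0_norm ?subr_ge0//; exact: wl.
rewrite gtr0_norm ?subr_gt0 ?ltr_expR// gtr0_norm ?subr_gt0//.
by apply: wl => //; exact: ltW.
Qed.

(** The difference quotients on the two sides of [x] are bounded separately and added. Straddling
    [x] is what lets the derivative at this single point control the increment. *)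
Lemma is_derive_le0_straddle (R : realType) (G : R -> R) (x l e : R) :
  is_derive x 1 G l -> l <= 0 -> 0 < e ->
  exists2 d : R, 0 < d & forall u v, u <= x <= v -> x - d < u -> v < x + d ->
    G v - G u <= e * (v - u).
Proof.
move=> [dG dGl] l0 e0.
have : h^-1 *: ((G \o shift x) (h *: 1) - G x) @[h --> 0^'] --> l.
  by rewrite -dGl; exact: dG.
move/cvgr_dist_le => /(_ _ e0); rewrite near_withinE.
move=> /nbhs_ballP[d /= d0 Hd]; exists d => // u v /andP[ux xv] du vd.
have key h : h != 0 -> `|h| < d -> `|l - h^-1 * (G (h + x) - G x)| <= e.
  move=> h0 hd; have := Hd h; rewrite /ball/= sub0r normrN => /(_ hd h0).
  by rewrite /GRing.scale/= mulr1.
have Gv : G v - G x <= e * (v - x).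
  have [->|xv'] := eqVneq v x; first by rewrite !subrr mulr0.
  have vx0 : 0 < v - x by rewrite subr_gt0 lt_neqAle eq_sym xv'.
  have := key (v - x); rewrite subrK => /(_ (lt0r_neq0 vx0)).
  rewrite gtr0_norm// => /(_ _)/ler_normlP[|H _]; first by lra.
  have : (v - x)^-1 * (G v - G x) <= e by lra.
  by rewrite mulrC ler_pdivrMr.
have Gu : G x - G u <= e * (x - u).
  have [->|ux'] := eqVneq u x; first by rewrite !subrr mulr0.
  have xu0 : 0 < x - u by rewrite subr_gt0 lt_neqAle ux'.
  have := key (u - x); rewrite subrK subr_eq0 => /(_ ux').
  rewrite ltr0_norm; last by lra.
  move=> /(_ _)/ler_normlP[|H _]; first by lra.
  have : (x - u)^-1 * (G x - G u) <= e.
    by rewrite -(opprB u x) -(opprB (G u)) invrN mulrNN; lra.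
  by rewrite mulrC ler_pdivrMr.
by lra.
Qed.

(** * Absolutely continuous functions *)

Lemma abs_continuousS (R : realType) (a b a' b' : R) (f : R -> R) :
  a <= a' -> b' <= b -> abs_continuous a b f -> abs_continuous a' b' f.
Proof.
move=> aa' b'b fAC e /fAC[d d0 Hd]; exists d => // n x y xy.
by apply: Hd => i; have [? ? ?] := xy i; split => //; lra.
Qed.

Lemma abs_continuous_unif (R : realType) (a b : R) (f : R -> R) :
  abs_continuous a b f ->
  forall e, 0 < e -> exists2 delta, 0 < delta & forall x y,
    a <= x <= b -> a <= y <= b -> `|x - y| < delta -> `|f x - f y| < e.
Proof.
move=> fAC e e0; have [d d0 Hd] := fAC e e0; exists d => //.
have wl x y : a <= x <= b -> a <= y <= b -> x <= y -> y - x < d ->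
    `|f y - f x| < e.
  move=> axb ayb xy yxd.
  have := Hd 1%N (fun=> x) (fun=> y); rewrite !big_ord1; apply => //.
    by move=> _; split=> //; lra.
  by move=> i j _ _ _; rewrite !ord1.
move=> x y axb ayb; have [xy|yx] := leP x y.
  by rewrite distrC ger0_norm ?subr_ge0// distrC => xyd; apply: wl.
by rewrite gtr0_norm ?subr_gt0// => xyd; apply: wl => //; exact: ltW.
Qed.

Lemma abs_continuous_bounded (R : realType) (a b : R) (f : R -> R) :
  abs_continuous a b f ->
  exists B : R, forall x, a <= x <= b -> `|f x| <= B.
Proof.
move=> /abs_continuous_unif/(_ _ ltr01)[d d0 Hd].
apply: locally_bounded_segment => t tab; exists d => //.
exists (`|f t| + 1) => x xab xtd.
have : `|x - t| < d by rewrite ltr_norml; lra.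
move=> /(Hd _ _ xab tab) xt1; have := ler_normD (f t) (f x - f t).
by rewrite addrC subrK; lra.
Qed.

Lemma abs_continuous_dominated (R : realType) (a b C : R) (f g : R -> R) :
  0 < C ->
  (forall x y, a <= x -> x <= y -> y <= b ->
    `|g y - g x| <= C * (`|f y - f x| + (y - x))) ->
  abs_continuous a b f -> abs_continuous a b g.
Proof.
move=> C0 gf fAC e e0.
(* The factor 2 shares [e] between the increments of [f] and the total length. *)
have eC : 0 < e / (2 * C) by rewrite divr_gt0// mulr_gt0.
have [d d0 Hd] := fAC _ eC.
exists (Num.min d (e / (2 * C))); first by rewrite lt_min d0.
move=> n x y xy xyI; rewrite lt_min => /andP[Sd Se].
have Sf := Hd n x y xy xyI Sd.
have : \sum_(i < n) `|g (y i) - g (x i)| <=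
    C * (\sum_(i < n) `|f (y i) - f (x i)| + \sum_(i < n) (y i - x i)).
  rewrite -big_split/= mulr_sumr; apply: ler_sum => i _.
  by have [? ? ?] := xy i; exact: gf.
move=> /le_lt_trans; apply; rewrite mulrC -ltr_pdivlMr//.
by rewrite invfM mulrA in Sf Se; lra.
Qed.

Lemma abs_continuous_sqr_expR (R : realType) (a b k : R) (f : R -> R) :
  abs_continuous a b f ->
  abs_continuous a b (fun t => f t ^+ 2 * expR (k * t)).
Proof.
move=> fAC; have [B0 HB0] := abs_continuous_bounded fAC.
pose B := Num.max B0 0.
have B_ge0 : 0 <= B by rewrite /B le_max lexx orbT.
have HB x : a <= x <= b -> `|f x| <= B.
  by move=> /HB0 fB; rewrite /B le_max fB.
pose D := expR (`|k| * (`|a| + `|b|)).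
have D0 : 0 < D by exact: expR_gt0.
have HD x : a <= x <= b -> expR (k * x) <= D.
  move=> /andP[ax xb]; rewrite ler_expR; apply: (le_trans (ler_norm _)).
  rewrite normrM ler_wpM2l//.
  have := ler_norm (- a); rewrite normrN => ?.
  have := (ler_norm b, normr_ge0 a, normr_ge0 b) => -[[? ?] ?].
  by rewrite ler_norml; lra.
(* The first two terms are the constants of [H1] and [H2] below; the added 1 makes [C] positive. *)
pose C := 2 * B * D + B ^+ 2 * D * `|k| + 1.
have C1_ge0 : 0 <= 2 * B * D by rewrite !mulr_ge0// ltW.
have C2_ge0 : 0 <= B ^+ 2 * D * `|k| by rewrite !mulr_ge0// ltW.
apply: (@abs_continuous_dominated R a b C f) => //.
  by rewrite /C; lra.
move=> x y ax xy yb.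
have xab : a <= x <= b by lra.
have yab : a <= y <= b by lra.
have -> : f y ^+ 2 * expR (k * y) - f x ^+ 2 * expR (k * x) =
    (f y + f x) * expR (k * y) * (f y - f x)
    + f x ^+ 2 * (expR (k * y) - expR (k * x)) by ring.
apply: (le_trans (ler_normD _ _)).
have H1 : `|(f y + f x) * expR (k * y) * (f y - f x)|
    <= 2 * B * D * `|f y - f x|.
  rewrite normrM ler_wpM2r// normrM (ger0_norm (expR_ge0 _)).
  apply: ler_pM => //; last exact: HD.
  by have := ler_normD (f y) (f x); have := HB _ xab; have := HB _ yab; lra.
have H2 : `|f x ^+ 2 * (expR (k * y) - expR (k * x))|
    <= B ^+ 2 * D * `|k| * (y - x).
  have -> : B ^+ 2 * D * `|k| * (y - x) = B ^+ 2 * (D * (`|k| * (y - x))).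
    by ring.
  rewrite normrM; apply: ler_pM => //.
    by rewrite normrX lerXn2r// ?nnegrE ?normr_ge0// HB.
  rewrite -(ger0_norm (_ : 0 <= y - x)) ?subr_ge0// -normrM mulrBr.
  by apply: expR_dist_le; exact: HD.
have ? := mulr_ge0 C2_ge0 (normr_ge0 (f y - f x)).
have yx0 : 0 <= y - x by rewrite subr_ge0.
have ? := mulr_ge0 C1_ge0 yx0.
by have ? := normr_ge0 (f y - f x); rewrite /C; lra.
Qed.

(** * Monotonicity from an almost everywhere nonpositive derivative *)

Lemma trivIset_ordered_itv (R : realType) (n : nat) (X Y : nat -> R) :
  (forall i j, (i < j < n)%N -> Y i <= X j) ->
  trivIset `I_n (fun i => `]X i, Y i[%classic).
Proof.
move=> XY; have disj i j : (i < j)%N -> (j < n)%N ->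
    `]X i, Y i[%classic `&` `]X j, Y j[%classic !=set0 -> False.
  move=> ij jn [z /= []]; rewrite !in_itv/= => /andP[_ zY] /andP[Xz _].
  by have := XY i j; rewrite ij jn => /(_ isT); lra.
move=> i j /= i_n j_n ne0; case: (ltngtP i j) => // [ij|ji].
- by case: (disj i j ij j_n ne0).
- by rewrite setIC in ne0; case: (disj j i ji i_n ne0).
Qed.

Lemma sum_itv_le_lebesgue_measure (R : realType) (n : nat) (X Y : nat -> R)
    (U : set R) : measurable U ->
  (forall i, (i < n)%N -> X i <= Y i) ->
  (forall i j, (i < j < n)%N -> Y i <= X j) ->
  (forall i, (i < n)%N -> `]X i, Y i[%classic `<=` U) ->
  ((\sum_(i < n) (Y i - X i))%:E <= lebesgue_measure U)%E.
Proof.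
move=> mU XleY YX subU.
have tI := trivIset_ordered_itv YX.
have mI : measurable (\big[setU/set0]_(k < n) `]X k, Y k[%classic).
  by apply: bigsetU_measurable => k _; exact: measurable_itv.
rewrite -sumEFin (eq_bigr (fun i : 'I_n =>
    @lebesgue_measure R `]X i, Y i[%classic)); last first.
  move=> i _; rewrite lebesgue_measure_itv/= lte_fin.
  case: ltP => [//|YleX]; congr EFin.
  by apply/eqP; rewrite subr_eq0 eq_le YleX XleY.
rewrite -(measure_semi_additive_ord_I (@lebesgue_measure R)
  (F := fun i => `]X i, Y i[%classic))//.
apply: le_measure; rewrite ?inE//.
rewrite -(bigcup_mkord n (fun i => `]X i, Y i[%classic)).
by move=> z [i /= i_n]; exact: subU.
Qed.

(* A fine tagged partition of [a, b] exists by compactness: cells tagged off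
   the exceptional null set increase G by at most e times their length, and the
   cells tagged in it lie in an open set of small measure, so that absolute
   continuity bounds their total contribution. *)
Lemma abs_continuous_derive_le0 (R : realType) (a b : R) (G : R -> R) :
  a <= b -> abs_continuous a b G ->
  {ae @lebesgue_measure R, forall x, a < x < b ->
    exists2 l, l <= 0 & is_derive x 1 G l} ->
  G b <= G a.
Proof.
move=> ab GAC Gae.
suff key e : 0 < e -> G b - G a <= e * (b - a) + e.
  rewrite -subr_le0; apply/ler_addgt0Pr => e e0; rewrite add0r.
  have ba : 0 < b - a + 1 by lra.
  (* Scaled so that the two error terms of [key] add up to exactly [e]. *)
  have /key : 0 < e / (b - a + 1) by rewrite divr_gt0.
  by move=> /le_trans; apply; rewrite -[X in _ + X]mulr1 -mulrDr divfK ?gt_eqF.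
move=> e0; have [dl dl0 Hdl] := GAC _ e0.
(* The endpoints join the exceptional set because the derivative is only controlled strictly inside
   [[a, b]]. *)
have [A [mA A0 NA]] : (@lebesgue_measure R).-negligible
    (~` [set x : R | a < x < b ->
       exists2 l, l <= 0 & is_derive x 1 G l] `|` [set a; b]).
  apply: negligibleU; first exact: Gae.
  apply: negligibleU; apply/negligibleP => //; exact: lebesgue_measure_set1.
have Afin : (lebesgue_measure A < +oo)%E by rewrite A0 ltry.
have [U [oU AU Udl]] := lebesgue_regularity_outer mA Afin dl0.
have mU : measurable U by exact: measurable_realfun.open_measurable.
have {}Udl : (lebesgue_measure U < dl%:E)%E.
  have -> : U = (U `\` A) `|` A by rewrite setUC setDUK.
  by rewrite measureU0//; exact: measurableD.
(* Only the cells inside [U] are recorded as intervals; the growth over all other cells is absorbed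
   in [e * (x - a)]. *)
pose P x := exists (n : nat) (X Y : nat -> R),
  [/\ forall i, (i < n)%N -> [/\ a <= X i, X i <= Y i, Y i <= x &
        `]X i, Y i[%classic `<=` U],
      forall i j, (i < j < n)%N -> Y i <= X j &
      G x - G a <= e * (x - a) + \sum_(i < n) (G (Y i) - G (X i))].
have [n [X [Y [XY XYdisj GP]]]] : P b.
  apply: (@straddle_induction R a b) => //.
    by exists 0%N, (fun=> 0), (fun=> 0); split=> //; rewrite big_ord0; lra.
  move=> t tab; have [Ut|nUt] := pselect (U t).
    have /nbhs_ballP[d /= d0 dU] := open_nbhs_nbhs (conj oU Ut).
    exists d => // x y axt tyb tx yt [n [X [Y [XY XYdisj GP]]]].
    (* The new cell goes last, at index [n]; the earlier ones end by [x], so the family stays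
       ordered. *)
    exists n.+1, (fun i => if i == n then x else X i),
      (fun i => if i == n then y else Y i); split.
    - move=> i; rewrite ltnS leq_eqVlt; case: eqP => [-> _|_ /= /XY].
        split; [lra|lra|lra|] => z; rewrite /= in_itv/= => /andP[xz zy].
        by apply: dU; rewrite /ball/= ltr_norml; lra.
      by move=> [? ? ? ?]; split => //; lra.
    - move=> i j /andP[ij]; rewrite ltnS leq_eqVlt => /predU1P[jn|jn].
        rewrite jn eqxx; rewrite jn in ij; rewrite ltn_eqF//.
        by have [] := XY _ ij.
      rewrite !ltn_eqF//; last exact: ltn_trans jn.
      by apply: XYdisj; rewrite ij.
    - rewrite big_ord_recr/= eqxx (eq_bigr (fun i : 'I_n => G (Y i) - G (X i))).
        have exy : 0 <= e * (y - x) by apply: mulr_ge0; lra.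
        by lra.
      by move=> i _; rewrite ltn_eqF.
  have nA : ~ A t by move=> /AU.
  have [l l0 Gl] : exists2 l, l <= 0 & is_derive t 1 G l.
    have [ta tb] : t != a /\ t != b.
      split; apply/eqP => tE; apply: nA; apply: NA; right; rewrite tE.
        by left.
      by right.
    apply: contrapT => nl; apply: nA; apply: NA; left => /= H; apply: nl.
    by apply: H; rewrite !lt_neqAle eq_sym ta tb.
  have [d d0 Hd] := is_derive_le0_straddle Gl l0 e0.
  exists d => // x y axt tyb tx yt [n [X [Y [XY XYdisj GP]]]].
  exists n, X, Y; split=> //.
    by move=> i /XY[? ? ? ?]; split => //; lra.
  have : G y - G x <= e * (y - x) by apply: Hd => //; lra.
  by lra.
apply: (le_trans GP); rewrite lerD2l.
have Sdl : \sum_(i < n) (Y i - X i) < dl.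
  rewrite -lte_fin; apply: le_lt_trans Udl.
  by apply: sum_itv_le_lebesgue_measure => // i /XY[].
apply: (@le_trans _ _ (\sum_(i < n) `|G (Y i) - G (X i)|)).
  by apply: ler_sum => i _; exact: ler_norm.
apply/ltW/Hdl => //; first by move=> i; have [] := XY i (ltn_ord i).
move=> i j _ _ ij; apply/val_inj.
by apply: (trivIset_ordered_itv XYdisj) => //=.
Qed.

(** * The barrier argument for exponentially weighted squares *)

Lemma is_derive_sqr_expR (R : realType) (f : R -> R) (k x l : R) :
  is_derive x 1 f l ->
  is_derive x 1 (fun t => f t ^+ 2 * expR (k * t))
    ((2 * f x * l + k * f x ^+ 2) * expR (k * x)).
Proof.
move=> fl.
have D1 := is_deriveM fl fl.
have D2 := is_derive1_comp (is_derive_expR (k * x))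
  (is_deriveZ k (is_derive_id x (1 : R))).
have -> : (fun t => f t ^+ 2 * expR (k * t)) = f * f * (expR \o (k \*: id)).
  by apply/funext => t; rewrite !fctE expr2.
apply: (is_derive_eq (is_deriveM D1 D2)).
by rewrite /GRing.scale/= !fctE; ring.
Qed.

(* [w] stays below [B]: since its last visit to the level [A] it has grown at
   rate at most [K], over a time at most [tau]. *)
Lemma sqr_expR_barrier (R : realType) (p p' tau K A B k : R) (f D : R -> R) :
  let w t := f t ^+ 2 * expR (k * t) in
  (forall q, p <= q < p' -> abs_continuous p q f) ->
  p' - p <= tau -> 0 <= K -> 0 <= A -> A * expR (K * tau) < B -> w p <= A ->
  {ae @lebesgue_measure R, forall t, p < t < p' -> is_derive t 1 f (D t)} ->
  (forall t, p < t < p' -> (forall s, p <= s <= t -> w s <= B) -> A <= w t ->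
    2 * f t * D t <= (K - k) * f t ^+ 2) ->
  forall t, p <= t < p' -> w t < B.
Proof.
move=> w fAC ptau K0 A0 AB wp fD growth t /andP[pt tp'].
have wcont x : p <= x < p' -> forall e, 0 < e ->
    exists2 delta, 0 < delta & forall y z,
    p <= y <= x -> p <= z <= x -> `|y - z| < delta -> `|w y - w z| < e.
  by move=> /fAC fx; apply/abs_continuous_unif/abs_continuous_sqr_expR.
apply: (@real_induction R p t (fun x => w x < B)); last by rewrite pt lexx.
- move=> x pxt wlt.
  have pxp' : p <= x < p' by lra.
  have px : p <= x by lra.
  (* After [s] the function stays above [A], so the growth hypothesis is available on all of []s,
     x[]. *)
  have [s [psx wsA exit]] := last_exit px wp (wcont _ pxp').
  (* Integrating factor: growth of [w] at rate at most [K] amounts to [G] being nonincreasing. *)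
  pose G y := f y ^+ 2 * expR ((k - K) * y).
  have Gw y : G y = w y * expR (- (K * y)).
    by rewrite /G /w mulrBl expRD mulrA.
  have : G x <= G s.
    apply: abs_continuous_derive_le0; first by lra.
      apply: (@abs_continuousS R p x); [lra|exact: lexx|].
      exact/abs_continuous_sqr_expR/fAC.
    apply: (negligibleS _ fD) => y /=; apply: contra_not => fDy syx.
    exists ((2 * f y * D y + (k - K) * f y ^+ 2) * expR ((k - K) * y)).
      apply: mulr_le0_ge0; last exact: expR_ge0.
      have : 2 * f y * D y <= (K - k) * f y ^+ 2.
        apply: growth; first by lra.
          by move=> z pzy; apply/ltW/wlt; lra.
        by apply/ltW/exit; lra.
      by lra.
    by apply/is_derive_sqr_expR/fDy; lra.
  rewrite !Gw expRN ler_pdivrMr ?expR_gt0// -mulrA -expRD => wxs.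
  apply: le_lt_trans wxs _; apply: le_lt_trans AB.
  apply: ler_pM => //; first by rewrite mulr_ge0 ?sqr_ge0 ?expR_ge0.
  rewrite ler_expR -mulrN -mulrDr ler_wpM2l//; lra.
- move=> x pxt wle.
  have wxB : w x < B by apply: wle; lra.
  have ptp' : p <= t < p' by rewrite pt.
  have [|d d0 Hd] := wcont _ ptp' (B - w x); first by rewrite subr_gt0.
  exists d => // y xyt yxd.
  have : `|y - x| < d by rewrite gtr0_norm; lra.
  move=> /Hd H; have /ltr_normlP[_] : `|w y - w x| < B - w x by apply: H; lra.
  by rewrite ltrD2r.
Qed.

(** * Estimates for the impulsive delayed system *)

(** Young's inequality with weight [r], separating the current state from the delayed one; the
    defect is a square over [r]. *)
Lemma double_product_le (R : realType) (r a x z : R) : 0 < r ->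
  2 * x * (a * z) <= r * x ^+ 2 + a ^+ 2 / r * z ^+ 2.
Proof.
move=> r0; rewrite -subr_ge0.
have -> : r * x ^+ 2 + a ^+ 2 / r * z ^+ 2 - 2 * x * (a * z) =
    (r * x - a * z) ^+ 2 / r by field; rewrite gt_eqF.
by rewrite divr_ge0 ?sqr_ge0// ltW.
Qed.

Lemma segment_norm_ub (R : realType) (dbar t0 : R) (xi : R -> R) :
  PC (- dbar) 0 (segment xi t0) ->
  forall t, t0 - dbar <= t <= t0 ->
    `|xi t| <= segment_norm dbar (segment xi t0).
Proof.
move=> /PC_bounded[B HB] t tt0.
apply: ub_le_sup.
  by exists B => _ [s /= + <-]; rewrite in_itv/=; exact: HB.
exists (t - t0); first by rewrite /= in_itv/=; lra.
by rewrite /segment addrC subrK.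
Qed.

(** The minimal spacing [eps] excludes accumulation of jumps, so the intervals between jumps exhaust
    the future. *)
Lemma jump_sequence_unbounded (R : realType) (eps tau t0 : R) (tk : nat -> R) :
  0 < eps -> jump_sequence eps tau t0 tk -> forall t, exists n, t < tk n.
Proof.
move=> eps0 [tk0 tkS] t.
have tk_ge n : t0 + n%:R * eps <= tk n.
  elim: n => [|n IHn]; first by rewrite mul0r addr0 tk0.
  by have := tkS n; rewrite -natr1; lra.
exists (Num.bound `|(t - t0) / eps|); apply: lt_le_trans (tk_ge _).
rewrite -ltrBlDl -ltr_pdivrMr//; apply: le_lt_trans (ler_norm _) _.
by apply: archi_boundP; exact: normr_ge0.
Qed.

(** Carries a bound on the weighted square to the left limit at a jump, which is the value that the
    jump equation multiplies by [c]. *)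
Lemma cvg_left_sqr_expR_le (R : realType) (f : R -> R) (k p q l C : R) :
  p < q -> f s @[s --> q^'-] --> l ->
  (forall s, p <= s < q -> f s ^+ 2 * expR (k * s) <= C) ->
  l ^+ 2 * expR (k * q) <= C.
Proof.
move=> pq fl fC.
have wl : f s ^+ 2 * expR (k * s) @[s --> q^'-] --> l ^+ 2 * expR (k * q).
  apply: cvgM; first exact: (cvgM fl fl).
  apply: cvg_at_left_filter.
  apply: (@continuous_comp _ _ _ ( *%R k) expR); last exact: continuous_expR.
  exact: mulrl_continuous.
apply: (ler_cvg_to wl (cvg_cst C)).
near=> s; apply: fC; apply/andP; split; last by near: s; exact: nbhs_left_lt.
by near: s; exact: nbhs_left_ge.
Unshelve. all: by end_near. Qed.

Lemma solution_ae_between (R : realType) (a c dbar eps tau t0 : R)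
    (d u nu : R -> R) (tk : nat -> R) (xi : R -> R) (n : nat) :
  0 < eps -> jump_sequence eps tau t0 tk -> solution a c dbar d u nu t0 tk xi ->
  {ae @lebesgue_measure R, forall t, tk n < t < tk n.+1 ->
    is_derive t 1 xi (a * xi (t - d t) + u t)}.
Proof.
move=> eps0 [tk0 tkS] [_ _ xi_ode _].
have tk_mono : {homo tk : m n / (m <= n)%N >-> m <= n}.
  by apply: homo_leq => [//|? ? ?|m]; [exact: le_trans|have := tkS m; lra].
apply: (negligibleS _ xi_ode) => t /=; apply: contra_not => H tn.
apply: H; first by have := tk_mono 0%N n (leq0n n); rewrite tk0; lra.
move=> i ti; have [ni|ni] := leqP n i.
  by have := tk_mono n.+1 i.+1; rewrite ltnS ni => /(_ isT); lra.
by have := tk_mono i.+1 n ni; lra.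
Qed.

(** Positivity of [V0] keeps both barriers strictly above their starting levels. Both cases for
    [lambda2] are covered by [c ^+ 2 <= lambda2]. *)
Lemma solution_sqr_le (R : realType) (a c dbar eps tau t0 : R)
    (d u nu : R -> R) (tk : nat -> R) (xi : R -> R)
    (r lambda2 lambda M V0 : R) :
  (forall t, 0 <= d t <= dbar) -> 0 < eps ->
  (forall t, u t = 0) -> (forall t, nu t = 0) ->
  0 < r -> 0 < lambda2 -> c ^+ 2 <= lambda2 -> 0 < lambda -> 1 < M ->
  tau * (lambda + r + a ^+ 2 / r * M * expR (- lambda * tau)) < ln M ->
  tau * (lambda + r + a ^+ 2 / r / lambda2 * expR (lambda * dbar))
    < - ln lambda2 ->
  jump_sequence eps tau t0 tk -> solution a c dbar d u nu t0 tk xi ->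
  0 < V0 -> (forall t, t0 - dbar <= t <= t0 -> xi t ^+ 2 <= V0) ->
  forall t, t0 - dbar <= t ->
    xi t ^+ 2 * expR (lambda * t) <= M * V0 * expR (lambda * t0).
Proof.
move=> d_range eps0 u0 nu0 r0 l20 cl2 l0 M1 hI hII hjump hsol V00 xi_hist.
have xi_ae n := solution_ae_between n eps0 hjump hsol.
have [tk0 tkS] := hjump; have [_ xiAC _ xi_jump] := hsol.
have M0 : 0 < M by lra.
pose l1 := a ^+ 2 / r.
have l1_ge0 : 0 <= l1 by rewrite divr_ge0 ?sqr_ge0// ltW.
have tau0 : 0 <= tau by have := tkS 0%N; lra.
have dbar0 : 0 <= dbar by have := d_range 0; lra.
pose C := M * V0 * expR (lambda * t0).
have C0 : 0 < C by rewrite !mulr_gt0 ?expR_gt0.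
pose w t := xi t ^+ 2 * expR (lambda * t).
have w_ge0 t : 0 <= w t := mulr_ge0 (sqr_ge0 _) (expR_ge0 _).
have fAC n q : tk n <= q < tk n.+1 -> abs_continuous (tk n) q xi.
  by move=> /xiAC.
have hist_t t : t0 - dbar <= t <= t0 -> w t <= C.
  move=> tt0; rewrite /w /C; apply: ler_pM; rewrite ?sqr_ge0 ?expR_ge0//.
    apply: le_trans (xi_hist _ tt0) _; rewrite ler_peMl//; lra.
  by rewrite ler_expR ler_wpM2l//; lra.
have first_interval t : tk 0%N <= t < tk 1%N -> w t <= C.
  move=> tt1; have tau1 := tkS 0%N.
  pose K := r + l1 * M * expR (- lambda * tau).
  pose B := M * expR (- lambda * tau) * V0.
  have H0 : 0 <= l1 * M * expR (- lambda * tau).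
    exact: mulr_ge0 (mulr_ge0 l1_ge0 (ltW M0)) (expR_ge0 _).
  (* After cancelling [V0] and taking logarithms this is condition (I). *)
  have V0B : V0 * expR (K * tau) < B.
    rewrite /B mulrC ltr_pM2r//.
    have -> : M = expR (ln M) by rewrite lnK// posrE.
    by rewrite -expRD ltr_expR /K /l1; lra.
  have V0leB : V0 <= B.
    apply/ltW/(le_lt_trans _ V0B); rewrite ler_peMr ?(ltW V00)//.
    by rewrite -expR0 ler_expR mulr_ge0//; rewrite /K; lra.
  have E s : xi s ^+ 2 * expR (0 * s) = xi s ^+ 2 by rewrite mul0r expR0 mulr1.
  (* Weight exponent 0: the barrier concerns the unweighted square here, starting from the level
     [V0]. *)
  have : xi t ^+ 2 * expR (0 * t) < B.
    apply: (sqr_expR_barrier (fAC 0%N) _ _ _ V0B _ (xi_ae 0%N)) => //.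
    - by case/andP: tau1.
    - by rewrite /K; lra.
    - exact: ltW.
    - by rewrite E; apply: xi_hist; lra.
    - move=> s s01; rewrite E => wB V0s; rewrite u0 addr0 subr0.
      apply: le_trans (double_product_le _ _ _ r0) _.
      have ds := d_range s.
      have xiB : xi (s - d s) ^+ 2 <= B.
        have [sd|sd] := leP (s - d s) t0.
          by apply: le_trans V0leB; apply: xi_hist; lra.
        by rewrite -E; apply: wB; lra.
      (* Above the level [V0], the barrier [B] is itself at most a multiple of the current square,
         which absorbs the delayed term. *)
      have : xi (s - d s) ^+ 2 <= M * expR (- lambda * tau) * xi s ^+ 2.
        apply: le_trans xiB _; rewrite ler_wpM2l//.
        by rewrite mulr_ge0 ?expR_ge0// ltW.
      by move=> /(ler_wpM2l l1_ge0); rewrite -/l1 /K; lra.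
  rewrite E /w => xiB.
  (* The factor [expR (- lambda * tau)] in [B] pays for the weight gained since [t0], as
     [t - t0 <= tau]. *)
  apply: (@le_trans _ _ (B * expR (lambda * t))).
    by rewrite ler_wpM2r ?expR_ge0// ltW.
  rewrite /B /C (mulrAC M) -(mulrA (M * V0)) ler_pM2l ?mulr_gt0//.
  rewrite -expRD ler_expR.
  rewrite mulNr -mulrN -mulrDr ler_wpM2l ?(ltW l0)//; lra.
have next_interval n :
    (forall t, t0 - dbar <= t < tk n.+1 -> w t <= C) ->
    forall t, tk n.+1 <= t < tk n.+2 -> w t <= C.
  move=> IH t tn; have taun := tkS n.+1.
  have tn1 : t0 <= tk n.+1.
    have {}tn : forall m, t0 <= tk m.
      by elim=> [|m ?]; [rewrite tk0|have := tkS m; lra].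
    exact: tn.
  pose K := lambda + r + l1 / lambda2 * expR (lambda * dbar).
  have H0 : 0 <= l1 / lambda2 * expR (lambda * dbar).
    by rewrite mulr_ge0 ?expR_ge0// divr_ge0// ltW.
  (* This is condition (II) exponentiated: [lambda2 * expR (K * tau) < 1]. *)
  have CB : lambda2 * C * expR (K * tau) < C.
    rewrite mulrAC gtr_pMl//.
    have -> : lambda2 = expR (ln lambda2) by rewrite lnK// posrE.
    rewrite -expRD expR_lt1.
    by rewrite /K /l1; lra.
  apply/ltW; apply: (sqr_expR_barrier (fAC n.+1) _ _ _ CB _ (xi_ae n.+1)) => //.
  - by case/andP: taun.
  - by rewrite /K; lra.
  - by rewrite mulr_ge0 ?ltW.
  - have [l xil ->] := xi_jump n; rewrite nu0 addr0 exprMn -mulrA.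
    have tn' : tk n < tk n.+1 by have := tkS n; lra.
    have lC : l ^+ 2 * expR (lambda * tk n.+1) <= C.
      apply: (cvg_left_sqr_expR_le tn' xil) => s sn; apply: IH.
      have : t0 <= tk n.
        by elim: (n) => [|m ?]; [rewrite tk0|have := tkS m; lra].
      by lra.
    exact: ler_pM (sqr_ge0 _) (mulr_ge0 (sqr_ge0 _) (expR_ge0 _)) cl2 lC.
  - move=> s sn wC; rewrite -/(w s) => Cws; rewrite u0 addr0.
    apply: le_trans (double_product_le _ _ _ r0) _; rewrite -/l1.
    have ds := d_range s.
    have wd : w (s - d s) <= C.
      have [sd|sd] := ltP (s - d s) (tk n.+1); first by apply: IH; lra.
      by apply: wC; lra.
    (* Here [lambda2 * w (s - d s) <= lambda2 * C <= w s]; comparing the weights at [s - d s] and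
       [s] costs at most [expR (lambda * dbar)]. *)
    have delayed :
        lambda2 * xi (s - d s) ^+ 2 <= expR (lambda * dbar) * xi s ^+ 2.
      rewrite -(ler_pM2r (expR_gt0 (lambda * s))) -[leRHS]mulrA.
      apply: le_trans (ler_wpM2l (expR_ge0 _) Cws).
      have -> : lambda * s = lambda * (s - d s) + lambda * d s by ring.
      rewrite expRD mulrCA mulrA -/(w (s - d s)).
      rewrite (_ : _ * _ * _ =
        expR (lambda * d s) * (lambda2 * w (s - d s))); last first.
        by rewrite /w; ring.
      apply: (ler_pM (expR_ge0 _) (mulr_ge0 (ltW l20) (w_ge0 _))).
        by rewrite ler_expR ler_wpM2l ?(ltW l0)//; lra.
      by rewrite ler_pM2l.
    have : xi (s - d s) ^+ 2 <= lambda2^-1 * (expR (lambda * dbar) * xi s ^+ 2).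
      by rewrite ler_pdivlMl.
    by move=> /(ler_wpM2l l1_ge0); rewrite /K; lra.
(* As [tk 0] is [t0], index 0 is the history and index 1 adds the jump-free first interval; jumps
   enter from index 2 on. *)
have all_n n t : t0 - dbar <= t < tk n -> w t <= C.
  elim: n t => [|n IHn] t tn; first by apply: hist_t; rewrite -tk0 in tn *; lra.
  have [tltn|nlet] := ltP t (tk n); first by apply: IHn; lra.
  case: n => [|n] in IHn tn nlet *; first by apply: first_interval; lra.
  by apply: (next_interval n) => //; lra.
move=> t tt0; have [n tn] := jump_sequence_unbounded eps0 hjump t.
by apply: (all_n n); rewrite tt0.
Qed.

(** * The exponential bound and uniform stability *)

Theorem lemma1 (R : realType) (a c dbar eps tau : R) (d u nu : R -> R)
  (hc : -1 < c < 1)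
  (hd : continuous d) (hd_range : forall t, 0 <= d t <= dbar)
  (heps : 0 < eps)
  (hu : forall t, u t = 0) (hnu : forall t, nu t = 0)
  (r lambda1 lambda2 lambda M : R)
  (hr : 0 < r)
  (hlambda1 : lambda1 = a ^+ 2 / r)
  (hlambda2 : c <> 0 -> lambda2 = c ^+ 2)
  (hlambda2_0 : c = 0 -> 0 < lambda2 < 1)
  (hlambda : 0 < lambda) (hM : 1 < M)
  (hI : tau * (lambda + r + lambda1 * M * expR (- lambda * tau)) < ln M)
  (hII : tau * (lambda + r + lambda1 / lambda2 * expR (lambda * dbar))
         < - ln lambda2) :
  UGES a c dbar d eps tau /\
  forall (t0 : R) (tk : nat -> R) (xi : R -> R),
    jump_sequence eps tau t0 tk ->
    solution a c dbar d u nu t0 tk xi ->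
    forall t : R, t0 <= t ->
      `|xi t| <= Num.sqrt M * segment_norm dbar (segment xi t0)
                 * expR (- (lambda / 2) * (t - t0)).
Proof.
have [l20 cl2] : 0 < lambda2 /\ c ^+ 2 <= lambda2.
  have [c0|/eqP c0] := eqVneq c 0.
    by rewrite c0 expr0n/=; case/andP: (hlambda2_0 c0) => /[dup] + /ltW.
  by rewrite (hlambda2 c0) lexx exprn_even_gt0//=; split => //; apply/eqP.
rewrite hlambda1 in hI hII.
(* Stated for all pointwise zero inputs, to serve both [u], [nu] and the literal zero functions in
   [UGES]. *)
have bound u' nu' : (forall t, u' t = 0) -> (forall t, nu' t = 0) ->
    forall (t0 : R) (tk : nat -> R) (xi : R -> R),
    jump_sequence eps tau t0 tk -> solution a c dbar d u' nu' t0 tk xi ->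
    forall t : R, t0 <= t ->
      `|xi t| <= Num.sqrt M * segment_norm dbar (segment xi t0)
                 * expR (- (lambda / 2) * (t - t0)).
  move=> u0 nu0 t0 tk xi hjump hsol t t0t.
  have dbar0 : 0 <= dbar by have := hd_range 0; lra.
  have [/segment_norm_ub xi_hist _ _ _] := hsol.
  set N := segment_norm _ _ in xi_hist *.
  have N0 : 0 <= N by apply: le_trans (xi_hist t0 _); rewrite ?normr_ge0//; lra.
  have sq_hist s : t0 - dbar <= s <= t0 -> xi s ^+ 2 <= N ^+ 2.
    by move=> /xi_hist ?; rewrite -real_normK ?num_real// lerXn2r// nnegrE.
  have : xi t ^+ 2 * expR (lambda * t) <= M * N ^+ 2 * expR (lambda * t0).
    (* The norm [N] may vanish while [V0] must be positive, so [N ^+ 2] is enlarged by an amount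
       that contributes exactly [e] to the final bound. *)
    apply/ler_addgt0Pr => e e0.
    have Me : 0 < M * expR (lambda * t0) by rewrite mulr_gt0 ?expR_gt0//; lra.
    have eta0 : 0 < e / (M * expR (lambda * t0)) by rewrite divr_gt0.
    have V0 : 0 < N ^+ 2 + e / (M * expR (lambda * t0)).
      by rewrite ltr_wpDl// sqr_ge0.
    have hist s : t0 - dbar <= s <= t0 ->
        xi s ^+ 2 <= N ^+ 2 + e / (M * expR (lambda * t0)).
      by move=> /sq_hist /le_trans; apply; rewrite lerDl ltW.
    have tdbar : t0 - dbar <= t by lra.
    apply: (le_trans (solution_sqr_le hd_range heps u0 nu0 hr l20 cl2 hlambda
      hM hI hII hjump hsol V0 hist tdbar)).
    rewrite mulrAC mulrDr (mulrC _ (e / _)) (divfK (lt0r_neq0 Me)).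
    by rewrite (mulrAC M (expR _)).
  move=> xit.
  (* Both sides are nonnegative, so their squares are compared; squaring turns the rate [lambda / 2]
     into [lambda]. *)
  rewrite -(@ler_pXn2r _ 2)// ?nnegrE ?mulr_ge0 ?sqrtr_ge0 ?expR_ge0//.
  rewrite real_normK ?num_real// !exprMn sqr_sqrtr; last by lra.
  rewrite -expRM_natr -(ler_pM2r (expR_gt0 (lambda * t))).
  apply: (le_trans xit); rewrite -[leRHS]mulrA -expRD.
  by rewrite le_eqVlt; apply/orP; left; apply/eqP; congr (_ * expR _); field.
split; last exact: bound hu hnu.
exists (lambda / 2), (Num.sqrt M); split; [by rewrite divr_gt0| |exact: bound].
by rewrite sqrtr_gt0; lra.
Qed.
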